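(* Let $\sigma$ be a primitive invertible substitution on the two-letter alphabet $\{a,b\}$ with $\det M_\sigma=1$. Then the following are equivalent: (1) $\sigma$ is selfdual; (2) $M_\sigma$ is of the form $$M_{m,k}=\begin{pmatrix} m & k\\ \frac{m^2-1}{k} & m\end{pmatrix}\quad\text{or}\quad M'_{m,k}=\begin{pmatrix} m & k\\ k & \frac{k^2+1}{m}\end{pmatrix},$$ with integers $m,k$, where $k\ge1$ divides $m^2-1$ (in the first case), respectively $m\ge1$ divides $k^2+1$ (in the second case); (3) $Q^{-1}M_\sigma Q=(M_\sigma)^{-1}$ for either $Q=\begin{pmatrix}-1&0\\0&1\end{pmatrix}$ or $Q=\begin{pmatrix}0&-1\\1&0\end{pmatrix}$; (4) $P^TM_\sigma P=(M_\sigma)^T$ for either $P=\begin{pmatrix}0&1\\1&0\end{pmatrix}$ or $P=\mathrm{id}$.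
   Context: A substitution $\sigma$ on $\mathcal{A}=\{a,b\}$ maps each letter to a nonempty finite word over $\mathcal A$, extended by concatenation. Its substitution matrix is $M_\sigma=(|\sigma(j)|_i)_{i,j\in\{a,b\}}$, where $|w|_i$ is the number of occurrences of the letter $i$ in $w$. $\sigma$ is primitive if $M_\sigma^n>0$ entrywise for some $n\in\mathbb{N}$, and invertible if the endomorphism of the free group $F_2=\langle a,b\rangle$ it induces is an automorphism. Two substitutions are conjugate, written $\sigma\sim\rho$, if there is $w\in F_2$ with $\sigma(x)=w\rho(x)w^{-1}$ for all $x\in F_2$. For $\sigma$ invertible with $\det M_\sigma=1$, the reciprocal substitution is $\overline{\sigma}:=\tau_a\sigma^{-1}\tau_a^{-1}$, where $\tau_a\in\mathrm{Aut}(F_2)$ is $a\mapsto a^{-1}$, $b\mapsto b$; it is a substitution on $\{a,b\}$. Let $E:a\mapsto b,\ b\mapsto a$. The substitution $\sigma$ is called selfdual if $\sigma\sim\overline{\sigma}$ or $\sigma\sim E\overline{\sigma}E$. *)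

(* Defs.v *)
From HB Require Import structures.
From mathcomp Require Import all_boot all_order all_algebra.

Set Implicit Arguments.
Unset Strict Implicit.
Unset Printing Implicit Defensive.

Import GRing.Theory.

(* The alphabet is 'I_2, so that letters index the rows and columns of
   2 x 2 matrices. *)
Notation letter := 'I_2 (only parsing).
Notation la := (ord0 : 'I_2).
Notation lb := (ord_max : 'I_2).

(* The free group F_2 is the set of reduced words over the signed letters
   (x, e), where (x, false) stands for x and (x, true) for x^-1. *)
Definition sletter := (letter * bool)%type.
Definition sinv (l : sletter) : sletter := (l.1, ~~ l.2).
Definition reduced (w : seq sletter) : bool :=
  sorted (fun l l' => l' != sinv l) w.

Record F2 := FreeWord { word :> seq sletter; _ : reduced word }.
HB.instance Definition _ := [isSub for word].
HB.instance Definition _ := [Choice of F2 by <:].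

Definition rcons_left (l : sletter) (w : seq sletter) : seq sletter :=
  if w is l' :: w' then (if l' == sinv l then w' else l :: w) else [:: l].

(* Reduced form of the concatenation of two words, the second one reduced. *)
Definition redcat (u v : seq sletter) : seq sletter := foldr rcons_left v u.

Lemma sinvK : involutive sinv.
Proof. by case=> x e; rewrite /sinv /= negbK. Qed.

Lemma reduced_rcons_left l w : reduced w -> reduced (rcons_left l w).
Proof.
case: w => [//|l' w] /=; case: eqP => [_ /path_sorted //|/eqP ne pw] /=.
by rewrite ne.
Qed.

Lemma reduced_redcat u v : reduced v -> reduced (redcat u v).
Proof. by move=> rv; elim: u => //= l u; apply: reduced_rcons_left. Qed.

Lemma rcons_leftK l w : reduced w -> rcons_left (sinv l) (rcons_left l w) = w.
Proof.
case: w => [|l' w] /=; first by rewrite sinvK eqxx.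
case: eqP => [->|_] /=; last by rewrite sinvK eqxx.
by case: w => [//|l2 w] /= /andP[/negbTE->].
Qed.

Lemma redcat_rcons_left l u v : reduced u -> reduced v ->
  redcat (rcons_left l u) v = rcons_left l (redcat u v).
Proof.
case: u => [//|l' u] /= ru rv; case: eqP => [->|//].
by rewrite -[l in RHS]sinvK sinvK -{1}[l]sinvK rcons_leftK // reduced_redcat.
Qed.

Lemma redcatA u v w : reduced v -> reduced w ->
  redcat u (redcat v w) = redcat (redcat u v) w.
Proof.
move=> rv rw; elim: u => //= l u ->.
by rewrite redcat_rcons_left // reduced_redcat.
Qed.

Lemma redcats0 u : reduced u -> redcat u [::] = u.
Proof.
elim: u => //= l [|l' u] //= IH ru.
rewrite IH; last by case/andP: ru.
by case/andP: ru => /negbTE /= ->.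
Qed.

Definition sinvw (w : seq sletter) : seq sletter := rev (map sinv w).

Lemma reduced_sinvw w : reduced w -> reduced (sinvw w).
Proof.
rewrite /reduced /sinvw rev_sorted sorted_map; apply: sub_sorted => l l' /=.
by rewrite sinvK eq_sym.
Qed.

Lemma redcat_cat u v w : redcat (u ++ v) w = redcat u (redcat v w).
Proof. exact: foldr_cat. Qed.

Lemma redcatVw w v : reduced v -> redcat (sinvw w) (redcat w v) = v.
Proof.
rewrite /sinvw; elim: w v => //= l w IH v rv.
rewrite rev_cons -cats1 redcat_cat /= rcons_leftK ?IH //.
exact: reduced_redcat.
Qed.

Lemma sinvwK : involutive sinvw.
Proof. by move=> w; rewrite /sinvw map_rev revK (mapK sinvK). Qed.

Definition F2_one : F2 := @FreeWord [::] isT.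
Definition F2_mul (u v : F2) : F2 := FreeWord (reduced_redcat u (valP v)).
Definition F2_inv (u : F2) : F2 := FreeWord (reduced_sinvw (valP u)).

Lemma F2_mulA : associative F2_mul.
Proof. by move=> u v w; apply/val_inj/redcatA; apply: valP. Qed.
Lemma F2_mul1 : left_id F2_one F2_mul.
Proof. by move=> u; apply: val_inj. Qed.
Lemma F2_mulr1 : right_id F2_one F2_mul.
Proof. by move=> u; apply: val_inj; apply: redcats0 (valP u). Qed.
Lemma F2_mulV : left_inverse F2_one F2_inv F2_mul.
Proof.
move=> u; apply: val_inj => /=.
by rewrite -{2}[word u]redcats0 ?redcatVw //; apply: valP.
Qed.
Lemma F2_mulrV : right_inverse F2_one F2_inv F2_mul.
Proof.
move=> u; rewrite -{1}[u](_ : F2_inv (F2_inv u) = u) ?F2_mulV //.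
by apply: val_inj; apply: sinvwK.
Qed.

HB.instance Definition _ := isGroup.Build F2
  F2_mulA F2_mul1 F2_mulr1 F2_mulV F2_mulrV.

Definition gen (x : letter) : F2 := @FreeWord [:: (x, false)] isT.

Section Lift.
Local Open Scope group_scope.
Variables (gT : groupType) (f : letter -> gT).

Definition slift (l : sletter) : gT := if l.2 then (f l.1)^-1 else f l.1.

Definition lift_word (w : seq sletter) : gT := foldr (fun l g => slift l * g) 1 w.
Definition F2_lift (w : F2) : gT := lift_word w.

Lemma slift_inv l : slift (sinv l) = (slift l)^-1.
Proof. by case: l => x [] /=; rewrite /slift /= ?invgK. Qed.

Lemma lift_rcons_left l w : lift_word (rcons_left l w) = slift l * lift_word w.
Proof.
case: w => [|l' w] //=; case: eqP => [->|] //=.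
by rewrite slift_inv mulgA mulgV mul1g.
Qed.

Lemma lift_redcat u v : lift_word (redcat u v) = lift_word u * lift_word v.
Proof. by elim: u => [|l u IH] /=; rewrite ?mul1g // lift_rcons_left IH mulgA. Qed.

Lemma F2_lift_gen x : F2_lift (gen x) = f x.
Proof. exact: mulg1. Qed.

Lemma F2_lift_mul : {morph F2_lift : u v / u * v}.
Proof. by move=> u v; apply: lift_redcat. Qed.

Lemma F2_lift1 : F2_lift 1 = 1.
Proof. by []. Qed.

HB.instance Definition _ :=
  isUMagmaMorphism.Build F2 gT F2_lift (F2_lift1, F2_lift_mul).
End Lift.

Lemma lift_word_gen w (rw : reduced w) : lift_word gen w = FreeWord rw.
Proof.
elim: w rw => [|l w IH] rw /=; first exact: val_inj.
have rw' : reduced w by apply: path_sorted rw.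
rewrite (IH rw'); apply: val_inj => /=.
rewrite (_ : word _ = [:: l]) /=; last by case: l {rw} => x [].
by case: w rw {IH rw'} => [//|l' w] /= /andP[/negbTE->].
Qed.

Lemma F2_lift_uniq (gT : groupType) (h : F2 -> gT) (f : letter -> gT) :
  {morph h : u v / (u * v)%g} -> (forall x, h (gen x) = f x) ->
  h =1 F2_lift f.
Proof.
move=> hM hg.
have h1 : h 1%g = 1%g by apply: (@mulgI _ (h 1%g)); rewrite -hM !mulg1.
have hV u : h (u^-1)%g = ((h u)^-1)%g.
  by apply: (@mulgI _ (h u)); rewrite -hM !mulgV h1.
case=> w rw; rewrite -(lift_word_gen rw) /F2_lift (lift_word_gen rw) /=.
rewrite -(lift_word_gen rw); elim: w {rw} => //= l w IH.
rewrite hM IH; congr (_ * _)%g.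
by case: l => x []; rewrite /slift /= ?hV hg.
Qed.

Section Inverse.
Variables (f : F2 -> F2) (fbij : bijective f).
Lemma bij_fiber y : exists x, f x == y.
Proof. by case: fbij => g _ gK; exists (g y); rewrite gK. Qed.

Definition inv_map (y : F2) : F2 := xchoose (bij_fiber y).

Lemma inv_mapK : cancel inv_map f.
Proof. by move=> y; apply/eqP; apply: xchooseP (bij_fiber y). Qed.
Lemma inv_mapVK : cancel f inv_map.
Proof. by move=> x; apply: (bij_inj fbij); rewrite inv_mapK. Qed.
End Inverse.

Definition tau_a : F2 -> F2 :=
  F2_lift (fun x => if x == la then ((gen la)^-1)%g else gen lb).

Definition swapE : F2 -> F2 :=
  F2_lift (fun x => if x == la then gen lb else gen la).

Lemma tau_aK : involutive tau_a.
Proof.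
have lift_id : id =1 F2_lift gen by apply: F2_lift_uniq.
move=> w; rewrite [RHS]lift_id; move: w.
apply: (F2_lift_uniq (h := tau_a \o tau_a)) => [u v | x] /=.
  by rewrite /tau_a !gmulfM.
by case: x => [[|[|//]] xP]; apply: val_inj; rewrite /= ?xP;
  congr [:: (_, _)]; apply: val_inj.
Qed.

Lemma tau_a_bij : bijective tau_a.
Proof. exact: inv_bij tau_aK. Qed.

Record substitution := Substitution {
  subst_fun :> letter -> seq letter;
  _ : forall x, subst_fun x != [::]
}.

Lemma reduced_positive (w : seq letter) : reduced [seq (x, false) | x <- w].
Proof.
by case: w => //= x w; elim: w x => //= y w IH x; rewrite IH andbT xpair_eqE andbF.
Qed.

Definition of_word (w : seq letter) : F2 := FreeWord (reduced_positive w).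

Definition subst_endo (s : substitution) : F2 -> F2 :=
  F2_lift (fun x => of_word (s x)).

Lemma subst_endo_word (s : substitution) (w : seq letter) :
  subst_endo s (of_word w) = of_word (flatten (map s w)).
Proof.
have of_cat u v : of_word (u ++ v) = (of_word u * of_word v)%g.
  apply: val_inj => /=; elim: u => //= x u <-.
  by case: (u ++ v) => [//|y t] /=; rewrite xpair_eqE andbF.
rewrite /subst_endo /F2_lift /=; elim: w => [|x w IH] /=; first exact: val_inj.
by rewrite of_cat -IH.
Qed.

Definition subst_mx (s : substitution) : 'M[int]_2 :=
  \matrix_(i, j) ((count_mem i (s j))%:Z)%R.

Definition primitive (s : substitution) : Prop :=
  exists n : nat, forall i j : letter, (0 < (subst_mx s ^+ n)%R i j)%R.

Definition invertible (s : substitution) : Prop := bijective (subst_endo s).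

Definition conjugate (f g : F2 -> F2) : Prop :=
  exists w : F2, forall x : F2, f x = (w * g x * w^-1)%g.

(* When s has determinant 1 this endomorphism is again induced by a
   substitution; conjugate compares endomorphisms of F_2, so that this fact is
   not needed to state selfduality. *)
Definition reciprocal (s : substitution) (si : invertible s) : F2 -> F2 :=
  tau_a \o inv_map si \o inv_map tau_a_bij.

Definition selfdual (s : substitution) (si : invertible s) : Prop :=
  conjugate (subst_endo s) (reciprocal si) \/
  conjugate (subst_endo s) (swapE \o reciprocal si \o swapE).

(* The matrix with rows (p, q) and (r, t). *)
Definition mx22 (p q r t : int) : 'M[int]_2 :=
  \matrix_(i, j) if i == la then (if j == la then p else q)
                 else (if j == la then r else t).

(* Main.v *)
From HB Require Import structures.
Require Import Defs.
From mathcomp Require Import all_boot all_order all_algebra.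
From mathcomp Require Import zify ring.

(** An automorphism of F_2 that maps the generators to positive words is, up to
    an inner automorphism, a product of the two elementary automorphisms
    [elem la], which sends b to ba and fixes a, and [elem lb], which sends a to
    ab and fixes b, followed on the right by the exchange of the generators when
    the determinant is -1 ([positive_basis_pos_aut]). So an invertible substitution of determinant 1
    is described up to conjugacy by a word [W] in the two elementary
    automorphisms.

    The decomposition is a form of Nielsen reduction for positive words. Two
    positive words that form a basis do not commute, hence have a common
    conjugation after which they are positive with different first letters. If
    one is then a suffix of the other, an elementary automorphism splits off.
    If not, only their common suffix can cancel in a product, so the length of
    the image of a group element is at least the length of that element
    ([folded_growth]); since the generators are attained, the two words are the
    two generators.

    Each elementary automorphism satisfies [elem c \o tau_a \o elem c ~ tau_a],
    so the reciprocal of the automorphism of [W] is conjugate to that of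
    [rev W] ([reciprocal_pos_aut]); conjugation by the exchange of the
    generators exchanges the two letters in the word. On matrices, reversing the
    word exchanges the diagonal entries, and reversing it and exchanging its
    letters is transposition. Conjugate automorphisms have the same matrix, and
    the two elementary matrices freely generate a monoid
    ([abmx_pos_aut_inj]), so the matrix determines the word. Hence the
    substitution is selfdual exactly when its matrix has equal diagonal entries
    or is symmetric ([selfdual_entries]). That each of the remaining conditions
    says the same is a computation with 2 x 2 matrices of determinant 1, in
    which primitivity excludes a zero off-diagonal entry. *)

Set Implicit Arguments.
Unset Strict Implicit.
Unset Printing Implicit Defensive.
Import GRing.Theory Num.Theory.
Local Open Scope ring_scope.

(** * Endomorphisms of the free group *)

(** Group endomorphisms of F_2. *)
Notation endo := (UMagmaMorphism.type F2 F2).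

Lemma letterP (x : 'I_2) : x = la \/ x = lb.
Proof. by case: x => [[|[|//]] xP]; [left|right]; apply: val_inj. Qed.

Lemma F2_word_ind (P : F2 -> Prop) :
    P 1%g -> (forall l w, P w -> P (slift gen l * w)%g) -> forall w, P w.
Proof.
move=> P1 PM; case=> w rw; rewrite -(lift_word_gen rw).
by elim: w {rw} => [//|l w IH] /=; apply: PM.
Qed.

(** An endomorphism is determined by the images of the two generators. *)
Lemma eq_endo (f g : endo) : (forall x, f (gen x) = g (gen x)) -> f =1 g.
Proof.
move=> fg w; rewrite (F2_lift_uniq (gmulfM (s := f)) (fun=> erefl)).
by rewrite -(F2_lift_uniq (gmulfM (s := g)) (fun x => esym (fg x))).
Qed.

(** * Conjugacy of endomorphisms *)

(** Conjugacy of endomorphisms can be tested on the generators. *)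
Lemma conjugate_gen (f g : endo) (w : F2) :
  (forall x, f (gen x) = (w * g (gen x) * w^-1)%g) -> conjugate f g.
Proof.
move=> fg; exists w => x; rewrite (F2_lift_uniq (gmulfM (s := f)) fg).
apply/esym/(F2_lift_uniq (h := fun x => (w * g x * w^-1)%g)) => // u v /=.
by rewrite gmulfM !mulgA mulgVK.
Qed.

Lemma eq_conjugate f g : f =1 g -> conjugate f g.
Proof. by move=> fg; exists 1%g => x; rewrite mul1g invg1 mulg1. Qed.

Lemma conjugate_sym f g : conjugate f g -> conjugate g f.
Proof.
by case=> w fg; exists (w^-1)%g => x; rewrite fg invgK !mulgA mulVg mul1g mulgVK.
Qed.

Lemma conjugate_trans f g h : conjugate f g -> conjugate g h -> conjugate f h.
Proof.
by move=> [v fg] [w gh]; exists (v * w)%g => x; rewrite fg gh invgM !mulgA.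
Qed.

Lemma conjugate_compr h f g : conjugate f g -> conjugate (f \o h) (g \o h).
Proof. by case=> w fg; exists w => x; apply: fg. Qed.

Lemma conjugate_compl (h : endo) f g :
  conjugate f g -> conjugate (h \o f) (h \o g).
Proof. by case=> w fg; exists (h w) => x; rewrite /= fg !gmulfM gmulfV. Qed.

Lemma conjugate_compl_bij (h : endo) f g :
  bijective h -> conjugate (h \o f) (h \o g) -> conjugate f g.
Proof.
move=> hbij [w]; rewrite -(inv_mapK hbij w) => fg.
exists (inv_map hbij w) => x; apply: (bij_inj hbij).
by rewrite !gmulfM gmulfV; apply: fg.
Qed.

Lemma conjugate_bij f g : conjugate f g -> bijective f -> bijective g.
Proof.
case=> w fg [h fK hK]; exists (fun y => h (w * y * w^-1)%g) => x.
  by rewrite -fg fK.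
apply: (@mulgI _ w); apply: (@mulIg _ (w^-1)%g); rewrite -fg hK //.
Qed.

(** * Abelianization *)

(** The exponent sum of the letter [i] in the signed word [w]. *)
Definition expo (i : 'I_2) (w : seq sletter) : int :=
  \sum_(l <- w) (l.1 == i)%:R * (-1) ^+ l.2.

Lemma expo_redcat i u v : expo i (redcat u v) = expo i u + expo i v.
Proof.
elim: u => [|l u IH] /=; first by rewrite /expo big_nil add0r.
rewrite [expo i (l :: u)]big_cons -/(expo i u) -addrA -IH.
case: (redcat u v) => [|l' w] /=; first by rewrite /expo !big_cons big_nil.
case: eqP => [->|_]; rewrite /expo !big_cons // /sinv /= addrA -mulrDr.
by case: l.2; rewrite ?addrN ?addNr mulr0 add0r.
Qed.

Lemma expoM i (u v : F2) : expo i (u * v)%g = expo i u + expo i v.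
Proof. exact: expo_redcat. Qed.

Lemma expo1 i : expo i (1%g : F2) = 0.
Proof. exact: big_nil. Qed.

Lemma expoV i (u : F2) : expo i (u^-1)%g = - expo i u.
Proof. by apply/eqP; rewrite -addr_eq0 -expoM mulVg expo1. Qed.

Lemma expo_gen i j : expo i (gen j) = (i == j)%:R.
Proof. by rewrite /expo big_seq1 mulr1 eq_sym. Qed.

(** The matrix of the endomorphism of Z^2 induced by [f]; as for substitutions,
    column [j] is the image of the generator [j]. *)
Definition abmx (f : F2 -> F2) : 'M[int]_2 := \matrix_(i, j) expo i (f (gen j)).

Lemma expo_endo (f : endo) i w : expo i (f w) = \sum_k abmx f i k * expo k w.
Proof.
elim/F2_word_ind: w => [|l w IH].
  by rewrite gmulf1 expo1 big1 // => k _; rewrite expo1 mulr0.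
rewrite gmulfM expoM IH.
under [RHS]eq_bigr => k _ do rewrite expoM mulrDr.
rewrite big_split /=; congr (_ + _).
have Hg x : expo i (f (gen x)) = \sum_k abmx f i k * expo k (gen x).
  rewrite (bigD1 x) //= expo_gen eqxx mulr1 mxE big1 ?addr0 // => k /negbTE kx.
  by rewrite expo_gen kx mulr0.
rewrite /slift; case: l.2; last exact: Hg.
rewrite gmulfV expoV Hg -sumrN; apply: eq_bigr => k _.
by rewrite expoV mulrN.
Qed.

Lemma abmx_comp (f : endo) (g : F2 -> F2) : abmx (f \o g) = abmx f *m abmx g.
Proof.
by apply/matrixP=> i j; rewrite !mxE expo_endo; apply: eq_bigr => k _; rewrite !mxE.
Qed.

Lemma abmx_conjugate f g : conjugate f g -> abmx f = abmx g.
Proof.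
case=> w fg; apply/matrixP=> i j.
by rewrite !mxE fg !expoM expoV addrAC addrN add0r.
Qed.

Lemma expo_of_word i (w : seq 'I_2) : expo i (of_word w) = (count_mem i w)%:Z.
Proof.
rewrite /expo /= big_map; elim: w => [|x w IH] /=; first by rewrite big_nil.
by rewrite big_cons IH mulr1 PoszD; case: (x == i).
Qed.

Lemma abmx_subst (s : substitution) : abmx (subst_endo s) = subst_mx s.
Proof.
by apply/matrixP=> i j; rewrite !mxE /subst_endo F2_lift_gen expo_of_word.
Qed.

HB.instance Definition _ (s : substitution) :=
  isUMagmaMorphism.Build F2 F2 (subst_endo s) (F2_lift1 _, F2_lift_mul _).
HB.instance Definition _ :=
  isUMagmaMorphism.Build F2 F2 tau_a (F2_lift1 _, F2_lift_mul _).
HB.instance Definition _ :=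
  isUMagmaMorphism.Build F2 F2 swapE (F2_lift1 _, F2_lift_mul _).

(** * Positive elementary automorphisms *)

(** The exchange of the two letters. *)
Notation other := (@rev_ord 2).

(** The elementary automorphism that fixes the generator [c] and sends the other
    generator [x] to [x c]. *)
Definition elem (c : 'I_2) : F2 -> F2 :=
  F2_lift (fun x => if x == c then gen x else (gen x * gen c)%g).
HB.instance Definition _ (c : 'I_2) :=
  isUMagmaMorphism.Build F2 F2 (elem c) (F2_lift1 _, F2_lift_mul _).

(** The positive automorphism of [W]: the composite of the elementary
    automorphisms listed by [W], the last one being applied first. *)
Definition pos_aut (W : seq 'I_2) : F2 -> F2 :=
  foldr (fun c f => elem c \o f) idfun W.
Lemma pos_aut1 W : pos_aut W 1%g = 1%g.
Proof. by elim: W => //= c W ->; rewrite gmulf1. Qed.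
Lemma pos_autM W : {morph pos_aut W : u v / (u * v)%g}.
Proof. by elim: W => [|c W IH] u v /=; rewrite ?(IH u v) ?gmulfM. Qed.
HB.instance Definition _ (W : seq 'I_2) :=
  isUMagmaMorphism.Build F2 F2 (pos_aut W) (pos_aut1 W, @pos_autM W).

Lemma pos_aut_cat V W x : pos_aut (V ++ W) x = pos_aut V (pos_aut W x).
Proof. by elim: V => //= c V ->. Qed.

Lemma elem_gen c x :
  elem c (gen x) = if x == c then gen x else (gen x * gen c)%g.
Proof. exact: F2_lift_gen. Qed.

Lemma swapE_gen x : swapE (gen x) = gen (other x).
Proof.
rewrite /swapE F2_lift_gen; have [->|->] := letterP x; congr gen; exact: val_inj.
Qed.

Lemma swapEK : involutive swapE.
Proof.
apply: (@eq_endo (swapE \o swapE) idfun) => x.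
change (swapE (swapE (gen x)) = gen x).
by rewrite !swapE_gen rev_ordK.
Qed.

Lemma elem_swapE c : elem c \o swapE =1 swapE \o elem (other c).
Proof.
apply: (@eq_endo (elem c \o swapE) (swapE \o elem (other c))) => x.
change (elem c (swapE (gen x)) = swapE (elem (other c) (gen x))).
rewrite swapE_gen !elem_gen.
rewrite -(inj_eq (@rev_ord_inj 2) (other x)) rev_ordK.
by case: (x == other c); rewrite ?gmulfM /= !swapE_gen ?rev_ordK.
Qed.

Lemma pos_aut_swapE W x : pos_aut W (swapE x) = swapE (pos_aut (map other W) x).
Proof. by elim: W => //= c W ->; apply: (elem_swapE c). Qed.

(** Up to conjugacy, [elem c] is its own reciprocal. *)
Lemma elem_tau_a c : conjugate (elem c \o tau_a \o elem c) tau_a.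
Proof.
have [->|->] := letterP c.
  apply: (@conjugate_gen (elem la \o tau_a \o elem la) tau_a 1%g) => x /=.
  rewrite mul1g invg1 mulg1.
  have [->|->] := letterP x; rewrite !elem_gen ?eqxx /=; exact: val_inj.
apply: (@conjugate_gen (elem lb \o tau_a \o elem lb) tau_a (gen lb)^-1%g) => x.
have [->|->] := letterP x; exact: val_inj.
Qed.

(** Taking reciprocals reverses the order of composition. *)
Lemma pos_aut_tau_a W : conjugate (pos_aut W \o tau_a \o pos_aut (rev W)) tau_a.
Proof.
elim: W => [|c W IH] /=; first exact: eq_conjugate.
apply: conjugate_trans (elem_tau_a c).
have h := conjugate_compl (elem c) (conjugate_compr (elem c) IH).
apply: conjugate_trans h; apply: eq_conjugate => x /=.
by rewrite rev_cons -cats1 pos_aut_cat.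
Qed.

(** Both sides become conjugate to [tau_a] after composition with the
    automorphism [subst_endo s \o tau_a], which can then be cancelled. *)
Lemma reciprocal_pos_aut (s : substitution) (si : invertible s) W :
  conjugate (subst_endo s) (pos_aut W) ->
  conjugate (reciprocal si) (pos_aut (rev W)).
Proof.
move=> sW; apply/conjugate_sym/(@conjugate_compl_bij (subst_endo s \o tau_a)).
  exact: bij_comp si tau_a_bij.
apply: (@conjugate_trans _ tau_a).
  by apply: conjugate_trans (pos_aut_tau_a W); do 2!apply: conjugate_compr.
apply: eq_conjugate => x; rewrite /reciprocal /= tau_aK inv_mapK.
by apply: (bij_inj tau_a_bij); rewrite inv_mapK tau_aK.
Qed.

(** * Integer matrices of size 2 *)

Lemma mx22E (A : 'M[int]_2) : A = mx22 (A la la) (A la lb) (A lb la) (A lb lb).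
Proof.
apply/matrixP=> i j; rewrite mxE.
by have [->|->] := letterP i; have [->|->] := letterP j.
Qed.

Lemma mx22_inj p q r t p' q' r' t' :
  mx22 p q r t = mx22 p' q' r' t' -> [/\ p = p', q = q', r = r' & t = t'].
Proof.
move=> /matrixP h.
by split; [have := h la la|have := h la lb|have := h lb la|have := h lb lb];
  rewrite !mxE.
Qed.

Lemma mulmx22 p q r t p' q' r' t' :
  mx22 p q r t *m mx22 p' q' r' t' =
  mx22 (p * p' + q * r') (p * q' + q * t') (r * p' + t * r') (r * q' + t * t').
Proof.
apply/matrixP=> i j; rewrite !mxE big_ord_recl big_ord1 !mxE /=.
by have [->|->] := letterP i; have [->|->] := letterP j.
Qed.

Lemma trmx22 p q r t : (mx22 p q r t)^T = mx22 p r q t.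
Proof.
apply/matrixP=> i j; rewrite !mxE.
by have [->|->] := letterP i; have [->|->] := letterP j.
Qed.

Lemma scalar_mx22 : 1%:M = mx22 1 0 0 1.
Proof. by rewrite [LHS]mx22E !mxE. Qed.

Lemma det_mx22 p q r t : \det (mx22 p q r t) = p * t - q * r.
Proof.
rewrite (expand_det_row _ ord0) big_ord_recl big_ord1 /cofactor !det_mx11 !mxE /=.
by rewrite /bump /= expr0 mul1r expr1 mulN1r mulrN.
Qed.

(** * Matrices of products of elementary automorphisms *)

Lemma abmx_pos_aut_cons c W :
  abmx (pos_aut (c :: W)) = abmx (elem c) *m abmx (pos_aut W).
Proof. exact: abmx_comp. Qed.

Lemma abmx_pos_aut_cat V W :
  abmx (pos_aut (V ++ W)) = abmx (pos_aut V) *m abmx (pos_aut W).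
Proof.
rewrite -abmx_comp; apply/matrixP=> i j; rewrite !mxE pos_aut_cat //.
Qed.

Lemma abmx_pos_aut0 : abmx (pos_aut [::]) = 1%:M.
Proof. by apply/matrixP=> i j; rewrite !mxE expo_gen. Qed.

Lemma abmx_swapE : abmx swapE = mx22 0 1 1 0.
Proof. by rewrite [LHS]mx22E !mxE !swapE_gen !expo_gen. Qed.

Lemma abmx_elem c : abmx (elem c) = if c == la then mx22 1 1 0 1 else mx22 1 0 1 1.
Proof.
rewrite [LHS]mx22E !mxE !elem_gen.
have lab : (la == lb) = false by [].
by have [->|->] := letterP c;
  rewrite ?eqxx ?[lb == la]eq_sym ?lab ?expoM !expo_gen.
Qed.

(** The matrix of [pos_aut W] belongs to SL_2(N). *)
Lemma abmx_pos_aut_SL2N W : exists p q r t : int,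
  [/\ abmx (pos_aut W) = mx22 p q r t, [/\ 0 <= p, 0 <= q, 0 <= r & 0 <= t]
    & p * t - q * r = 1].
Proof.
elim: W => [|c W [p [q [r [t [E [p0 q0 r0 t0] d]]]]]].
  by exists 1, 0, 0, 1; rewrite abmx_pos_aut0 scalar_mx22.
rewrite abmx_pos_aut_cons E abmx_elem; case: ifP => _; rewrite mulmx22.
  exists (p + r), (q + t), r, t; split; first by congr mx22; ring.
    by split; lia.
  by rewrite -d; ring.
exists p, q, (p + r), (q + t); split; first by congr mx22; ring.
  by split; lia.
by rewrite -d; ring.
Qed.

(** The matrices of [elem la] and [elem lb] generate a free monoid: left
    multiplication by the former makes the first row dominate the second one,
    the latter does the opposite, and the two rows of an invertible matrix are
    not equal. *)
Lemma abmx_pos_aut_inj : injective (abmx \o pos_aut).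
Proof.
have diff V W : abmx (pos_aut (la :: V)) = abmx (pos_aut (lb :: W)) -> False.
  rewrite !abmx_pos_aut_cons !abmx_elem /=.
  have [p [q [r [t [-> [p0 q0 r0 t0] d]]]]] := abmx_pos_aut_SL2N V.
  have [p' [q' [r' [t' [-> [p0' q0' r0' t0'] d']]]]] := abmx_pos_aut_SL2N W.
  rewrite !mulmx22 => /mx22_inj[e1 e2 e3 e4].
  have p_0 : p = 0 by lia.
  have q_0 : q = 0 by lia.
  by move: d; rewrite p_0 q_0 !mul0r.
have diff0 c W : abmx (pos_aut (c :: W)) = abmx (pos_aut [::]) -> False.
  rewrite abmx_pos_aut_cons abmx_pos_aut0 scalar_mx22 abmx_elem.
  have [p [q [r [t [-> [p0 q0 r0 t0] d]]]]] := abmx_pos_aut_SL2N W.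
  by case: ifP => _; rewrite mulmx22 => /mx22_inj[e1 e2 e3 e4]; lia.
elim=> [|c V IH] [|c' W] //=; rewrite -?/(pos_aut (_ :: _)) => E.
- by have := diff0 c' W (esym E).
- by have := diff0 c V E.
have cc' : c = c'.
  move: E; have [->|->] := letterP c; have [->|->] := letterP c' => //.
    by move=> /diff.
  by move=> /esym /diff.
rewrite -cc' in E *; congr (c :: _); apply: IH => /=.
move: E; rewrite -!/(pos_aut (c :: _)) !abmx_pos_aut_cons => E.
have u : abmx (elem c) \in unitmx.
  by rewrite unitmxE abmx_elem; case: ifP; rewrite det_mx22.
by rewrite -[LHS](mulKmx u) E mulKmx.
Qed.

Lemma abmx_pos_aut_map W :
  abmx (pos_aut (map other W)) =
  mx22 0 1 1 0 *m abmx (pos_aut W) *m mx22 0 1 1 0.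
Proof.
rewrite -abmx_swapE -mulmxA -!abmx_comp; apply/matrixP=> i j; rewrite !mxE /=.
by rewrite pos_aut_swapE swapEK.
Qed.

(** The two elementary matrices are transposes of each other, so reversing the
    word and exchanging its letters transposes the matrix. *)
Lemma abmx_pos_aut_tr W : abmx (pos_aut (map other (rev W))) = (abmx (pos_aut W))^T.
Proof.
elim: W => [|c W IH]; first by rewrite !abmx_pos_aut0 trmx1.
rewrite rev_cons map_rcons -cats1 abmx_pos_aut_cat IH !abmx_pos_aut_cons.
rewrite abmx_pos_aut0 mulmx1 trmx_mul; congr (_ *m _); rewrite !abmx_elem.
by have [->|->] := letterP c; rewrite /= trmx22.
Qed.

(** * Words *)

Lemma common_prefix (T : eqType) (p q : seq T) :
    size p = size q -> p != q ->
  exists w x y p' q', [/\ p = w ++ x :: p', q = w ++ y :: q' & x != y].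
Proof.
elim: p q => [|x p IH] [|y q] //= [spq]; rewrite eqseq_cons.
have [<- /=|nxy _] := eqVneq x y; last by exists [::], x, y, p, q.
by move=> /(IH _ spq)[w [x' [y' [p' [q' [-> -> ?]]]]]]; exists (x :: w), x', y', p', q'.
Qed.

Lemma common_suffix (T : eqType) (x0 : T) (u v : seq T) :
  exists s u' v', [/\ u = u' ++ s, v = v' ++ s
    & [\/ u' = [::], v' = [::]
       | [/\ u' != [::], v' != [::] & last x0 u' != last x0 v']]].
Proof.
elim/last_ind: u v => [|u x IH] v.
  by exists [::], [::], v; rewrite !cats0; split=> //; constructor.
case/lastP: v => [|v y].
  by exists [::], (rcons u x), [::]; rewrite !cats0; split=> //; constructor 2.
have [<-|nxy] := eqVneq x y.
  have [s [u' [v' [-> -> h]]]] := IH v.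
  by exists (rcons s x), u', v'; rewrite !rcons_cat.
exists [::], (rcons u x), (rcons v y); rewrite !cats0 !last_rcons; split=> //.
by constructor 3; rewrite -!size_eq0 !size_rcons.
Qed.

Lemma cat_eq_cat (T : eqType) (p q w r : seq T) :
  p ++ q = w ++ r -> (size w <= size p)%N -> exists2 p', p = w ++ p' & p' ++ q = r.
Proof.
elim: w p => [|x w IH] [|y p] //=; try by exists [::]. by exists (y :: p).
by case=> -> /IH h /h [p' -> <-]; exists p'.
Qed.

(** Two nonempty words that do not commute are conjugate, by a common positive
    word, to positive words with different first letters: the conjugating word
    [w] is the longest common prefix of [u ++ v] and [v ++ u]. *)
Lemma conj_heads (T : eqType) (u v : seq T) :
    u != [::] -> v != [::] -> u ++ v != v ++ u ->
  exists w x y u' v', [/\ u ++ w = w ++ x :: u', v ++ w = w ++ y :: v' & x != y].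
Proof.
move=> u0 v0 nuv; have suv : size (u ++ v) = size (v ++ u).
  by rewrite !size_cat addnC.
have [w [x [y [p [q [Ep Eq nxy]]]]]] := common_prefix suv nuv.
have [||u' Eu Eu'] := @cat_eq_cat _ (u ++ w) (y :: q) w (x :: p ++ u).
- by rewrite -catA -Eq catA Ep -catA.
- by rewrite size_cat leq_addl.
have [||v' Ev Ev'] := @cat_eq_cat _ (v ++ w) (x :: p) w (y :: q ++ v).
- by rewrite -catA -Ep catA Eq -catA.
- by rewrite size_cat leq_addl.
case: u' Eu Eu' => [|x' u'] Eu.
  move/(congr1 size): Eu; rewrite cats0 size_cat => /eqP.
  by rewrite -{2}[size w]add0n eqn_add2r size_eq0 (negbTE u0).
case: v' Ev Ev' => [|y' v'] Ev.
  move/(congr1 size): Ev; rewrite cats0 size_cat => /eqP.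
  by rewrite -{2}[size w]add0n eqn_add2r size_eq0 (negbTE v0).
case=> Ey _ [Ex _].
by exists w, x, y, u', v'; rewrite Eu Ev Ex Ey.
Qed.

Lemma of_word_cat u v : of_word (u ++ v) = (of_word u * of_word v)%g.
Proof.
apply: val_inj => /=; elim: u => //= x u <-.
by case: (u ++ v) => [//|y t] /=; rewrite xpair_eqE andbF.
Qed.

Lemma of_word_inj : injective of_word.
Proof. by move=> u v [] /inj_map; apply=> x y []. Qed.

Lemma redcat_reduced u v : reduced (u ++ v) -> redcat u v = u ++ v.
Proof.
elim: u => //= l u IH h; rewrite IH; last exact: path_sorted h.
by case: (u ++ v) h => [//|l' w] /= /andP[/negbTE-> _].
Qed.

Lemma reduced_join u v : reduced u -> reduced v ->
    (if u is l :: u' then if v is l' :: _ then l' != sinv (last l u') else true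
     else true) ->
  reduced (u ++ v).
Proof.
case: u => [//|l u] /=; rewrite /reduced /= cat_path => ->.
by case: v => [//|l' v] /= -> ->.
Qed.

(** * Pairs of positive words in which only a common suffix cancels *)

(** The images of the generators are [blk x ++ s], where the two words [blk x]
    have different first letters and different last letters. The subgroup they
    generate is read along the loops of a graph with two vertices and three
    edges, labelled [blk la], [blk lb] and [s], in which no folding is possible. *)
Section Folded.
Variables (blk : 'I_2 -> seq 'I_2) (s : seq 'I_2).
Hypothesis blk_heads : injective (fun x => ohead (blk x)).
Hypothesis blk_lasts : injective (fun x => last la (blk x)).
Hypothesis blk0 : forall x, blk x != [::].

Let phi := F2_lift (fun x => of_word (blk x ++ s)).
Let pos (w : seq 'I_2) : seq sletter := [seq (x, false) | x <- w].

(** In the image of a reduced word only the factors [s] can cancel, so that each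
    letter [x] contributes at least the nonempty word [blk x]. The induction
    keeps track of how the image starts; when the first letter is the inverse of
    [x], the prefix [sinvw (pos s)] is not counted in the length, since a
    generator put in front would cancel it. *)
Lemma folded_growth (g : seq sletter) : reduced g ->
  (size g <= size (lift_word (fun x => of_word (blk x ++ s)) g))%N.
Proof.
set f := fun x => _.
suff: reduced g -> match g with
  | [::] => True
  | (x, false) :: _ =>
    ohead (lift_word f g) = omap (pair^~ false) (ohead (blk x)) /\
    (size g <= size (lift_word f g))%N
  | (x, true) :: _ =>
    exists r : seq sletter,
      word (lift_word f g) = sinvw (pos s) ++ (last la (blk x), true) :: r /\
      (size g <= (size r).+1)%N
  end.
  move=> h /[dup] rg /h; case: g {h rg} => [//|[x []] g]; last by case.
  by case=> r [-> hs]; apply: leq_trans hs _; rewrite size_cat leq_addl.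
elim: g => [//|[x e] g IH] rg.
have {IH}IH := IH (path_sorted rg).
have rgr : reduced (word (lift_word f g)) := valP _.
have sinvw_cat u v : sinvw (u ++ v) = sinvw v ++ sinvw u.
  by rewrite /sinvw map_cat rev_cat.
have rpos u : reduced (pos u) := reduced_positive u.
case: e rg => rg; last first.
  have -> : word (lift_word f ((x, false) :: g)) =
    redcat (pos (blk x ++ s)) (lift_word f g) by [].
  have [y [b Eb]] : exists y b, blk x = y :: b.
    by case: (blk x) (blk0 x) => // y b _; exists y, b.
  case: g rg IH rgr => [|[z []] g] rg IH rgr.
  - by rewrite redcats0 // Eb.
  - case: IH => r [Er sr]; rewrite Er in rgr *.
    rewrite /pos map_cat redcat_cat -/(pos s) -/(pos _).
    (* the factor s cancels *)
    have -> : redcat (pos s) (sinvw (pos s) ++ (last la (blk z), true) :: r) =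
        (last la (blk z), true) :: r.
      have rr : reduced ((last la (blk z), true) :: r) := (cat_sorted2 rgr).2.
      rewrite -(redcat_reduced rgr) -{1}[pos s]sinvwK redcatVw //.
    rewrite redcat_reduced; last first.
      apply: reduced_join => //; first exact: (cat_sorted2 rgr).2.
      case Eq: (pos (blk x)) => [//|l p].
      have -> : last l p = (last la (blk x), false).
        by move: Eq; rewrite Eb /= => -[<- <-]; rewrite last_map.
      rewrite /sinv /= xpair_eqE andbT; apply: contraTneq rg => /blk_lasts->.
      by rewrite /= /sinv /= eqxx.
    rewrite Eb /=; split=> //; rewrite size_cat /=; move: sr => /=; lia.
  - case: IH => hr sr.
    have [y' [r Er]] : exists y' (r : seq sletter),
        word (lift_word f ((z, false) :: g)) = (y', false) :: r.
      move: hr; case: (blk z) (blk0 z) => // y' b' _.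
      by case: (word _) => [//|l r] [->]; exists y', r.
    rewrite Er in rgr sr *.
    rewrite redcat_reduced; last first.
      apply: reduced_join => //; rewrite Eb /= last_map.
      by rewrite xpair_eqE andbF.
    rewrite Eb /=; split=> //; rewrite size_cat /= size_map; move: sr => /=; lia.
have -> : word (lift_word f ((x, true) :: g)) =
  redcat (sinvw (pos (blk x ++ s))) (lift_word f g) by [].
have [y [b Eb]] : exists y b, blk x = rcons b y.
  by case/lastP: (blk x) (blk0 x) => // b y _; exists y, b.
rewrite /pos map_cat sinvw_cat -/(pos s) -/(pos _).
have Ew : sinvw (pos (blk x)) = (last la (blk x), true) :: sinvw (pos b).
  by rewrite Eb last_rcons /pos map_rcons /sinvw map_rcons rev_rcons.
have rU : reduced (sinvw (pos s) ++ sinvw (pos (blk x))).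
  by rewrite -sinvw_cat -map_cat; apply/reduced_sinvw/reduced_positive.
suff [rr sr] : reduced ((sinvw (pos s) ++ sinvw (pos (blk x))) ++ lift_word f g) /\
    (size g <= size (lift_word f g))%N.
  rewrite redcat_reduced // -catA Ew; eexists; split; first reflexivity.
  by rewrite size_cat; move: sr => /=; lia.
have Eh : exists y' b', blk x = y' :: b'.
  by case: (blk x) (blk0 x) => // y' b' _; exists y', b'.
case: Eh => y' [b' Eb'].
have lastU l0 : last l0 (sinvw (pos s) ++ sinvw (pos (blk x))) = (y', true).
  by rewrite last_cat /sinvw Eb' /= rev_cons last_rcons.
case: g rg IH rgr => [|[z []] g] rg IH rgr.
- by rewrite cats0.
- case: IH => r [Er sr]; rewrite Er in rgr *; split; last first.
    by rewrite size_cat; move: sr => /=; lia.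
  apply: reduced_join => //.
  case Eq: (_ ++ _) (lastU (la, true)) => [//|l p] /= ->.
  (* both sides of the junction are inverses of letters: no cancellation *)
  case Es: (sinvw (pos s)) => [|l' p'] /=; first by rewrite xpair_eqE andbF.
  have : l' \in sinvw (pos s) by rewrite Es inE eqxx.
  rewrite /sinvw mem_rev => /mapP[l2 /mapP[l3 _ ->] ->].
  by rewrite /sinv xpair_eqE andbF.
- case: IH; move: (word _) rgr => w rw hr sr; split=> //.
  apply: reduced_join => //.
  case Eq: (_ ++ _) (lastU (la, true)) => [//|l p] /= ->.
  move: hr; have := @blk_heads x z; rewrite Eb'.
  case: (blk z) (blk0 z) => // y2 b2 _ /= hxz.
  case: w {rw sr} => [//|l2 r] [->].
  rewrite /sinv /= xpair_eqE andbT; apply: contraTneq rg => e.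
  by rewrite -hxz ?e //= /sinv /= eqxx.
Qed.

(** A preimage of a generator has length at most 1, hence is a generator, the
    image of the inverse of a generator having negative exponent sums. *)
Lemma folded_surj c : (exists g, phi g = gen c) -> exists x, blk x ++ s = [:: c].
Proof.
case=> -[g rg]; rewrite /phi /F2_lift /= => E.
have := folded_growth rg; rewrite E /=.
case: g rg E => [//|[x e] [|//]] rg /= E _; exists x.
move: E; rewrite mulg1 /slift /=; case: e {rg} => E; last first.
  by apply: of_word_inj; rewrite E; apply: val_inj.
move/(congr1 (fun u : F2 => expo c u)): E; rewrite expoV expo_gen eqxx.
by rewrite expo_of_word; lia.
Qed.
End Folded.

(** * Decomposition of positive bases *)

(** The endomorphism that sends each generator [x] to the positive word [t x]. *)
Definition endo_of (t : 'I_2 -> seq 'I_2) : F2 -> F2 :=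
  F2_lift (fun x => of_word (t x)).
HB.instance Definition _ (t : 'I_2 -> seq 'I_2) :=
  isUMagmaMorphism.Build F2 F2 (endo_of t) (F2_lift1 _, F2_lift_mul _).

Lemma endo_of_gen t x : endo_of t (gen x) = of_word (t x).
Proof. exact: F2_lift_gen. Qed.

Lemma elem_bij c : bijective (elem c).
Proof.
have h : bijective (elem c \o tau_a \o elem c).
  exact: conjugate_bij (conjugate_sym (elem_tau_a c)) tau_a_bij.
case: h => k /= hk kh; exists (fun y => k (elem c (tau_a y))) => [x|y]; first exact: hk.
by rewrite -[y]kh /= hk.
Qed.

Lemma ord2_inj (T : Type) (f : 'I_2 -> T) : f la <> f lb -> injective f.
Proof.
move=> h x y; have [->|->] := letterP x; have [->|->] := letterP y => //.
by move=> /esym.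
Qed.

(** An automorphism that maps the generators to positive words is conjugate to
    some [pos_aut W], possibly composed on the right with the exchange of the
    generators. The proof is by induction on the total length of the images:
    after a conjugation their first letters differ, and if [s] is their longest
    common suffix, then either one of them is [s], and an elementary
    automorphism can be factored out on the right, or the no-cancellation
    argument shows that they are the two generators. *)
Lemma positive_basis_pos_aut (t : 'I_2 -> seq 'I_2) : bijective (endo_of t) ->
  exists W, conjugate (endo_of t) (pos_aut W) \/
            conjugate (endo_of t) (pos_aut W \o swapE).
Proof.
have [n] := ubnP (size (t la) + size (t lb)).
elim: n t => // n IH t; rewrite ltnS => sz tbij.
have tinj := bij_inj tbij.
have t0 x : t x != [::].
  apply/eqP=> tx; have : gen x = 1%g.
    by apply: tinj; rewrite gmulf1 endo_of_gen tx; apply: val_inj.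
  by move/(congr1 word).
have tC : t la ++ t lb != t lb ++ t la.
  apply/eqP=> /(congr1 of_word); rewrite !of_word_cat -!endo_of_gen -!gmulfM.
  by move=> /tinj/(congr1 word).
have [w [x [y [u [v [Eu Ev nxy]]]]]] := conj_heads (t0 la) (t0 lb) tC.
(* t' is t conjugated by w; its two values start with different letters *)
pose t' c := if c == la then x :: u else y :: v.
have tw c : t c ++ w = w ++ t' c by have [->|->] := letterP c.
have stt' c : size (t c) = size (t' c).
  by have := congr1 size (tw c); rewrite !size_cat addnC => /addnI.
have tt' : conjugate (endo_of t) (endo_of t').
  apply: (@conjugate_gen (endo_of t) (endo_of t') (of_word w)) => c.
  by rewrite /= !endo_of_gen -of_word_cat -tw of_word_cat mulgK.
suff [W hW] : exists W, conjugate (endo_of t') (pos_aut W) \/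
                        conjugate (endo_of t') (pos_aut W \o swapE).
  by exists W; case: hW => h; [left|right]; apply: conjugate_trans tt' h.
have t'bij := conjugate_bij tt' tbij.
rewrite !stt' in sz; move=> {t t0 tinj tbij tC Eu Ev tw stt' tt'}.
have [s [u' [v' [Eu Ev h]]]] := common_suffix la (t' la) (t' lb).
pose b c := if c == la then u' else v'.
have tb c : t' c = b c ++ s by have [->|->] := letterP c.
have [[c bc]|[u0 v0 luv]] : (exists c, b c = [::]) \/
  [/\ u' != [::], v' != [::] & last la u' != last la v'].
- by case: h => [h|h|h]; [left; exists la|left; exists lb|right].
- have {}bc : t' c = s by rewrite tb bc.
  (* [s] is the image of [c], and factoring out [elem c] leaves t'' *)
  pose t'' z := if z == c then s else b z.
  have Et : endo_of t' =1 endo_of t'' \o elem c.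
    apply: (@eq_endo (endo_of t') (endo_of t'' \o elem c)) => z.
    change (endo_of t' (gen z) = endo_of t'' (elem c (gen z))).
    rewrite endo_of_gen elem_gen tb; case: ifP => zc.
      by rewrite endo_of_gen /t'' zc -tb (eqP zc) bc.
    by rewrite gmulfM /= !endo_of_gen /t'' zc eqxx of_word_cat.
  have sb : (0 < size s)%N.
    by rewrite -bc /t'; case: ifP.
  have t''bij : bijective (endo_of t'').
    have [k ek ke] := elem_bij c.
    apply: (@eq_bij _ _ (endo_of t' \o k)); last by move=> z /=; rewrite Et /= ke.
    by apply: bij_comp => //; exists (elem c).
  have [|W hW] := IH t'' _ t''bij.
    have ea := congr1 size (tb la); have eb := congr1 size (tb lb).
    apply: leq_trans sz; rewrite ea eb !size_cat /t'' {ea eb}.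
    move: sb; have [->|->] := letterP c; rewrite eqxx /=;
      by move: (size s) (size (b la)) (size (b lb)) => i j k; lia.
  case: hW => hW; have := conjugate_compr (elem c) hW => {}hW.
  + exists (rcons W c); left.
    apply: conjugate_trans (eq_conjugate Et) _; apply: conjugate_trans hW _.
    by apply: eq_conjugate => z /=; rewrite -cats1 pos_aut_cat.
  + exists (rcons W (other c)); right.
    apply: conjugate_trans (eq_conjugate Et) _; apply: conjugate_trans hW _.
    apply: eq_conjugate => z /=; rewrite -cats1 pos_aut_cat /=.
    by have /= := elem_swapE (other c) z; rewrite rev_ordK => ->.
- have bsurj c : exists z, t' z = [:: c].
    have [||||z hz] := @folded_surj b s _ _ _ c.
    + apply: ord2_inj; move: (tb la) (tb lb); rewrite /t' /b /=.
      case: (u') u0 => // x' u1 _; case: (v') v0 => // y' v1 _ [<- _] [<- _] [].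
      exact/eqP.
    + by apply: ord2_inj; apply/eqP.
    + by move=> z; rewrite /b; case: ifP.
    + case: t'bij => k _ kt; exists (k (gen c)); rewrite -[RHS]kt.
      apply/esym/(F2_lift_uniq (gmulfM (s := endo_of t'))) => z.
      by rewrite -tb; apply: endo_of_gen.
    by exists z; rewrite tb.
  have [za hza] := bsurj la; have [zb hzb] := bsurj lb.
  have nab : la != lb by [].
  exists [::]; move: hza hzb; have [->|->] := letterP za => ta.
  + have [->|->] := letterP zb => tb'.
      by case: (elimN eqP nab); move: tb'; rewrite ta => -[].
    left; apply: eq_conjugate; apply: (@eq_endo (endo_of t') (pos_aut [::])) => z.
    change (endo_of t' (gen z) = gen z); rewrite endo_of_gen.
    by have [->|->] := letterP z; rewrite ?ta ?tb'; apply: val_inj.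
  + have [->|->] := letterP zb => tb'; last first.
      by case: (elimN eqP nab); move: tb'; rewrite ta => -[].
    right; apply: eq_conjugate; apply: (@eq_endo (endo_of t') swapE) => z.
    change (endo_of t' (gen z) = swapE (gen z)); rewrite endo_of_gen swapE_gen.
    have oa : other la = lb by exact: val_inj.
    have ob : other lb = la by exact: val_inj.
    by have [->|->] := letterP z; rewrite ?oa ?ob ?ta ?tb'; apply: val_inj.
Qed.

(** * Selfdual substitutions *)

Lemma det1_pos_aut (s : substitution) :
    invertible s -> \det (subst_mx s) = 1 ->
  exists W, conjugate (subst_endo s) (pos_aut W).
Proof.
move=> sbij; have [W [sW|sW]] := positive_basis_pos_aut sbij; first by exists W.
rewrite -abmx_subst (abmx_conjugate sW) abmx_comp abmx_swapE.
have [p [q [r [t [-> _ d]]]]] := abmx_pos_aut_SL2N W.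
by rewrite mulmx22 det_mx22; lia.
Qed.

(** The reciprocal of the positive automorphism of [W] is, up to conjugacy, that
    of [rev W], and conjugation by [swapE] exchanges the letters of the word.
    Positive automorphisms with different words have different matrices, hence
    are not conjugate. *)
Lemma selfdual_palindrome (s : substitution) (si : invertible s) W :
    conjugate (subst_endo s) (pos_aut W) ->
  selfdual si <-> W = rev W \/ W = map other (rev W).
Proof.
move=> sW; have rW := reciprocal_pos_aut si sW.
have rW' : conjugate (swapE \o reciprocal si \o swapE)
                     (pos_aut (map other (rev W))).
  apply: conjugate_trans (conjugate_compr swapE (conjugate_compl swapE rW)) _.
  by apply: eq_conjugate => x /=; rewrite pos_aut_swapE swapEK.
split=> -[h|h].
- left; apply: abmx_pos_aut_inj; apply: abmx_conjugate.
  by apply: conjugate_trans rW; apply: conjugate_trans h; apply: conjugate_sym.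
- right; apply: abmx_pos_aut_inj; apply: abmx_conjugate.
  by apply: conjugate_trans rW'; apply: conjugate_trans h; apply: conjugate_sym.
- by left; apply: conjugate_trans sW _; rewrite h; apply: conjugate_sym.
- by right; apply: conjugate_trans sW _; rewrite h; apply: conjugate_sym.
Qed.

(** Reversal of the word exchanges the diagonal entries of the matrix, reversal
    with exchange of the letters exchanges the other two. *)
Lemma selfdual_entries (s : substitution) (si : invertible s) :
    \det (subst_mx s) = 1 ->
  selfdual si <-> subst_mx s la la = subst_mx s lb lb \/
                  subst_mx s la lb = subst_mx s lb la.
Proof.
move=> sdet; have [W sW] := det1_pos_aut si sdet.
rewrite (selfdual_palindrome si sW) -abmx_subst (abmx_conjugate sW).
have tr := abmx_pos_aut_tr W; have sw := abmx_pos_aut_map (map other (rev W)).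
rewrite (mapK rev_ordK) tr in sw.
move: tr sw; rewrite [abmx (pos_aut W)]mx22E trmx22 !mulmx22.
set p := _ la la; set q := _ la lb; set r := _ lb la; set t := _ lb lb => tr sw.
have EW : abmx (pos_aut W) = mx22 p q r t by exact: mx22E.
rewrite !mxE /=; split=> -[h|h].
- by left; move: sw; rewrite -h EW => /mx22_inj[]; lia.
- by right; move: tr; rewrite -h EW => /mx22_inj[].
- by left; apply: abmx_pos_aut_inj; rewrite /= EW sw h; congr mx22; ring.
- by right; apply: abmx_pos_aut_inj; rewrite /= EW tr h.
Qed.

(** If this entry were zero, all powers of the matrix would be lower triangular. *)
Lemma primitive_offdiag (s : substitution) : primitive s -> subst_mx s la lb != 0.
Proof.
case=> n h; apply/eqP=> q0; suff E k : (subst_mx s ^+ k) la lb = 0.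
  by have := h la lb; rewrite E.
elim: k => [|k IH]; first by rewrite expr0 mxE.
rewrite exprS mxE big_ord_recl big_ord1 IH mulr0 add0r.
by rewrite (_ : lift _ _ = lb) ?q0 ?mul0r //; apply: val_inj.
Qed.

Lemma invmx_conj (R : comUnitRingType) n (M Q : 'M[R]_n) :
    Q \in unitmx -> M \in unitmx ->
  invmx Q *m M *m Q = invmx M <-> M *m Q *m M = Q.
Proof.
move=> uQ uM; split=> [E|E].
  by rewrite -(mulKVmx uQ (M *m Q)) (mulmxA (invmx Q)) E -mulmxA mulVmx // mulmx1.
have MQ : M *m Q = Q *m invmx M by rewrite -{2}E mulmxK.
by rewrite -mulmxA MQ mulKmx.
Qed.

Theorem theorem6p4 (s : substitution) (hprim : primitive s)
    (hinv : invertible s) (hdet : \det (subst_mx s) = 1) :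
  [<-> selfdual hinv;
       (exists m k : int,
          [/\ 1 <= k, (k %| m ^+ 2 - 1)%Z
            & subst_mx s = mx22 m k ((m ^+ 2 - 1) %/ k)%Z m])
       \/
       (exists m k : int,
          [/\ 1 <= m, (m %| k ^+ 2 + 1)%Z
            & subst_mx s = mx22 m k k ((k ^+ 2 + 1) %/ m)%Z]);
       exists2 Q : 'M[int]_2,
         Q = mx22 (-1) 0 0 1 \/ Q = mx22 0 (-1) 1 0
         & invmx Q *m subst_mx s *m Q = invmx (subst_mx s);
       exists2 P : 'M[int]_2,
         P = mx22 0 1 1 0 \/ P = 1%:M
         & P^T *m subst_mx s *m P = (subst_mx s)^T].
Proof.
have ge0 i j : 0 <= subst_mx s i j by rewrite mxE.
move: (selfdual_entries hinv hdet) (primitive_offdiag hprim).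
move: (ge0 la la) (ge0 la lb) (ge0 lb la) (ge0 lb lb) (mx22E (subst_mx s)).
move: (subst_mx s la la) (subst_mx s la lb) (subst_mx s lb la) (subst_mx s lb lb).
move=> p q r t p0 q0 r0 t0 sM sd qn0.
have uM : subst_mx s \in unitmx by rewrite unitmxE hdet unitr1.
rewrite sM in hdet uM *; have d := hdet; rewrite det_mx22 in d.
tfae.
- move=> /sd[pt|qr].
  (* the upper right entry is nonzero, by primitivity *)
  + left; exists p, q; have E : p ^+ 2 - 1 = r * q by rewrite -d -pt; ring.
    by rewrite E dvdz_mull // mulzK // pt; split=> //; lia.
  + right; exists p, q; have E : q ^+ 2 + 1 = t * p by rewrite -d -qr; ring.
    have pn0 : p != 0 by apply: contra_eq_neq d => ->; nia.
    by rewrite E dvdz_mull // mulzK // qr; split=> //; lia.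
- move=> pq; have {}pq : p = t \/ q = r.
    by case: pq => -[m [k [_ _ /mx22_inj[]]]] => *; [left|right]; congruence.
  case: pq => [pt|qr].
  + exists (mx22 (-1) 0 0 1); first by left.
    apply/(invmx_conj _ uM); first by rewrite unitmxE det_mx22.
    by rewrite !mulmx22 -pt; congr mx22; nia.
  + exists (mx22 0 (-1) 1 0); first by right.
    apply/(invmx_conj _ uM); first by rewrite unitmxE det_mx22.
    by rewrite !mulmx22 -qr; congr mx22; nia.
- case=> Q QE /invmx_conj; rewrite uM => h.
  have {}h : mx22 p q r t *m Q *m mx22 p q r t = Q.
    by apply: h => //; case: QE => ->; rewrite unitmxE det_mx22.
  case: QE h => ->; rewrite !mulmx22 => /mx22_inj[e1 e2 e3 e4].
  + exists (mx22 0 1 1 0); first by left.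
    have pt : p = t by apply: (mulIf qn0); nia.
    by rewrite !trmx22 !mulmx22 pt; congr mx22; ring.
  + exists 1%:M; first by right.
    have qr : q = r by nia.
    by rewrite trmx1 mul1mx mulmx1 trmx22 qr.
- case=> P [->|->] E; apply/sd.
  + by left; move: E; rewrite !trmx22 !mulmx22 => /mx22_inj[]; lia.
  + by right; move: E; rewrite trmx1 mul1mx mulmx1 trmx22 => /mx22_inj[].
Qed.
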